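(* Let $F$ be a field with $\operatorname{char} F\neq2$, let $A$ be a $(2,3)$-palintropic $F$-algebra, and let $c\in\operatorname{Idm}(A)$ be a nonsingular idempotent. Then: (M1) $L(c)$ is an algebra homomorphism $A\to A$. (M2) For any idempotent $c'\in\operatorname{Idm}(A)$, either $cc'=0$ or $cc'\in\operatorname{Idm}(A)$. (M3) $\ker L(c)=A_c(0)$ is an ideal of $A$.
   Context: All algebras are commutative, not necessarily associative, possibly infinite-dimensional; the base field has characteristic different from $2$ throughout. A commutative algebra $A$ is $(2,3)$-palintropic if $(x^3)^2-(x^2)^3=0$ for all $x\in A$, where $x^2=xx$, $x^3=x(xx)$, $(x^3)^2=x^3x^3$, $(x^2)^3=x^2(x^2x^2)$. $L(a)x=ax$. $\operatorname{Idm}(A)$ is the set of nonzero idempotents of $A$. $c\in\operatorname{Idm}(A)$ is nonsingular if $\mathrm{Id}-2L(c)$ is invertible. $A_c(\lambda)=\ker(L(c)-\lambda\,\mathrm{Id})$.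
   Formalization: When F is the field with 3 elements, where the claim fails if the identity is required only at elements of A, the identity (x^3)^2=(x^2)^3 is assumed formally, i.e. for all x in A[t]; for every other field of characteristic not 2 the statement is the literal one. *)

(* Defs.v *)
From HB Require Import structures.
From mathcomp Require Import all_boot all_order all_algebra.

Set Implicit Arguments.
Unset Strict Implicit.
Unset Printing Implicit Defensive.

Import GRing.Theory.
Local Open Scope ring_scope.

(* A commutative nonassociative algebra over F is a left module A : lmodType F
   together with a commutative product mul : {bilinear A -> A -> A}.  No unit,
   associativity or finite dimension is assumed. *)

Definition sq (T : Type) (mul : T -> T -> T) (x : T) : T := mul x x.

Definition cube (T : Type) (mul : T -> T -> T) (x : T) : T :=
  mul x (sq mul x).

Definition palintropic23 (V : zmodType) (mul : V -> V -> V) : Prop :=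
  forall x : V, sq mul (cube mul x) - cube mul (sq mul x) = 0.

(* The product of A[t] = A (x)_F F[t]; a polynomial in t with coefficients in A
   is given by its sequence of coefficients. *)
Definition poly_mul (V : zmodType) (mul : V -> V -> V) (a b : nat -> V) :
    nat -> V :=
  fun n => \sum_(i < n.+1) mul (a i) (b (n - i)%N).

(* A[t] is (2,3)-palintropic, i.e. the identity holds formally in A: over a
   field, this is the same as asking it in every scalar extension of A.  It
   follows from [palintropic23] when F has at least 7 elements, but not when
   F has 3. *)
Definition formally_palintropic23 (V : zmodType) (mul : V -> V -> V) : Prop :=
  forall a : nat -> V,
    (exists N : nat, forall n : nat, (N <= n)%N -> a n = 0) ->
  forall n : nat,
    sq (poly_mul mul) (cube (poly_mul mul) a) n
      - cube (poly_mul mul) (sq (poly_mul mul) a) n = 0.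

Definition ker (V : zmodType) (f : V -> V) : {pred V} := [pred x | f x == 0].

Definition Idm (V : zmodType) (mul : V -> V -> V) : {pred V} :=
  [pred c | (c != 0) && (mul c c == c)].

Definition nonsingular (F : fieldType) (A : lmodType F) (mul : A -> A -> A)
    (c : A) : Prop :=
  bijective (fun x : A => x - 2%:R *: mul c x).

Definition Peirce (F : fieldType) (A : lmodType F) (mul : A -> A -> A)
    (c : A) (lambda : F) : {pred A} :=
  ker (fun x : A => mul c x - lambda *: x).

Definition algebra_hom (F : fieldType) (A : lmodType F) (mul : A -> A -> A)
    (f : A -> A) : Prop :=
  linear f /\ (forall x y : A, f (mul x y) = mul (f x) (f y)).

Definition ideal (F : fieldType) (A : lmodType F) (mul : A -> A -> A)
    (I : {pred A}) : Prop :=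
  GRing.submod_closed I
    /\ (forall a x : A, x \in I -> (mul a x \in I) /\ (mul x a \in I)).

(* Main.v *)
Require Import Defs.
From HB Require Import structures.
From mathcomp Require Import all_boot all_order all_algebra.

Import GRing.Theory.
Local Open Scope ring_scope.

Set Implicit Arguments.
Unset Strict Implicit.
Unset Printing Implicit Defensive.

(** Write L for the multiplication by the idempotent c, fix y in A, and compare
    both sides of the identity (x^3)^2 = (x^2)^3 at x = c + t y.  The
    coefficients of 1 and t agree in every commutative algebra.  The coefficient
    of t^2 in the difference of the two sides is
      (L z)^2 - L (z^2),   where z = y - 2 L y
    ([palintropic_linear_poly_coef2]).  When c is nonsingular every element of A
    is such a z, so L commutes with squaring; as 2 is invertible, polarization
    shows that L is multiplicative.  Idempotents are then sent to idempotents
    or to 0, and the kernel of L is an ideal.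

    What has to be justified is that the coefficient of t^2 vanishes.  Over the
    field with 3 elements this is the formal identity.  Over any other field
    of characteristic not 2 there is t with t^3 <> t, so that 1, -1, t, -t are
    distinct and nonzero.  The difference of the two sides is a polynomial of
    degree at most 6 in t, with values in A, that vanishes on F.  Its
    coefficient of degree 6 is the identity at y, hence zero; its even part is
    thus a combination of t^2 and t^4 only, which its vanishing at 1 and at t
    kills ([coef2_eq0_of_vanishing]). *)

(** * Evaluation of polynomials with coefficients in an algebra *)

Section PolynomialsOverAlgebra.

Variables (F : fieldType) (A : lmodType F) (mul : {bilinear A -> A -> A}).
Implicit Types (a b : nat -> A) (m n : nat) (t : F) (x y : A).

Definition deg_le a n := forall i, (n < i)%N -> a i = 0.

(** The degree bound n is explicit because a sequence of coefficients carries no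
    bound of its own; the value does not depend on it ([eval_widen]). *)
Definition eval n t a : A := \sum_(0 <= i < n.+1) t ^+ i *: a i.

Definition linear_poly x y : nat -> A :=
  fun i => match i with 0 => x | 1 => y | _ => 0 end.

Lemma deg_le_linear_poly x y : deg_le (linear_poly x y) 1.
Proof. by case=> [|[]]. Qed.

Lemma eval_widen a n m t : deg_le a n -> (n <= m)%N -> eval m t a = eval n t a.
Proof.
move=> an le_nm; rewrite /eval (big_cat_nat (leq0n n.+1)) //=.
rewrite [X in _ + X]big_nat [X in _ + X]big1 ?addr0 // => i /andP[lt_ni _].
by rewrite an ?scaler0.
Qed.

Lemma deg_le_mul a b m n :
  deg_le a m -> deg_le b n -> deg_le (poly_mul mul a b) (m + n).
Proof.
move=> am bn k lt_k; apply: big1 => i _.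
have [lt_mi|le_im] := ltnP m i; first by rewrite am // linear0l.
rewrite [b _]bn ?linear0r // ltn_subRL (leq_trans _ lt_k) // ltnS.
by rewrite leq_add2r.
Qed.

Lemma lead_coef_mul a b m n : deg_le a m -> deg_le b n ->
  poly_mul mul a b (m + n)%N = mul (a m) (b n).
Proof.
move=> am bn; have lt_m : (m < (m + n).+1)%N by rewrite ltnS leq_addr.
rewrite /poly_mul (bigD1 (Ordinal lt_m)) //= addKn big1 ?addr0 // => i ne_im.
have [lt_mi|le_im] := ltnP m i; first by rewrite am // linear0l.
have lt_im : (i < m)%N by rewrite ltn_neqAle le_im andbT.
by rewrite [b _]bn ?linear0r // ltn_subRL ltn_add2r.
Qed.

Lemma eval_mul a b m n t : deg_le a m -> deg_le b n ->
  eval (m + n) t (poly_mul mul a b) = mul (eval m t a) (eval n t b).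
Proof.
move=> am bn; rewrite -(eval_widen t am (leq_addr n m)) {1 2}/eval.
rewrite linear_sumlz.
(* The double sum over i and j = k - i, with zero terms added so that both
   outer ranges are the same and can be exchanged. *)
transitivity (\sum_(0 <= k < (m + n).+1) \sum_(0 <= i < (m + n).+1 | (i <= k)%N)
                t ^+ k *: mul (a i) (b (k - i)%N)).
  apply: eq_big_nat => k /andP[_ lt_k].
  rewrite /poly_mul scaler_sumr.
  rewrite -(big_mkord predT (fun i => t ^+ k *: mul (a i) (b (k - i)%N))).
  by rewrite (@big_nat_widen _ _ _ 0 k.+1 (m + n).+1) //.
rewrite (exchange_big_dep_nat predT) //=.
apply: eq_big_nat => i /andP[_ lt_i].
have [lt_mi|le_im] := ltnP m i.
  by rewrite am // scaler0 linear0l big1 // => k _; rewrite linear0l scaler0.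
rewrite -(big_nat_widenl i 0 (m + n).+1 predT) //.
rewrite -{1}[i]add0n big_addn subSn // -(@eval_widen _ n (m + n - i)) //; last first.
  by rewrite leq_subRL ?leq_add2r // (leq_trans le_im) ?leq_addr.
rewrite /eval linear_sumr; apply: eq_big_nat => j _.
by rewrite addnK linearZl_LR linearZr_LR /= scalerA -exprD addnC.
Qed.

End PolynomialsOverAlgebra.

(** * Extracting the coefficient of degree 2 *)

Section CoefficientExtraction.

Variables (F : fieldType) (A : lmodType F).

Lemma two_neq0 : 2%N \notin [pchar F] -> 2%:R != 0 :> F.
Proof. by apply: contraNneq => two0; rewrite inE /= two0. Qed.

Lemma addrr_inj : 2%N \notin [pchar F] -> injective (fun x : A => x + x).
Proof.
move=> charF x y /=; rewrite -!mulr2n -!scaler_nat.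
by move/(scalerI (two_neq0 charF)).
Qed.

(** Counting the roots of t (p 1 + t p 2 + ... + t^4 p 5) would require 5
    nonzero scalars, and the field with 5 elements has only 4.  Since p 6 = 0
    and p 0 is the value at 0, adding the values
    at s and -s leaves 2 s^2 (p 2 + s^2 p 4), so that s = 1 and s = t suffice:
    they give (1 - t^2) p 2 = 0. *)
Lemma coef2_eq0_of_vanishing (p : nat -> A) (t : F) :
    2%N \notin [pchar F] -> t ^+ 3 != t ->
    (forall s, eval 6 s p = 0) -> p 6 = 0 -> p 2 = 0.
Proof.
move=> charF t3 p_eval p6.
have p0 : p 0 = 0.
  rewrite -[RHS](p_eval 0) /eval big_nat_recl // big1 => [|i _].
    by rewrite expr0 scale1r addr0.
  by rewrite exprS mul0r scale0r.
have even_part s : s ^+ 2 *: (p 2 + s ^+ 2 *: p 4) = 0.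
  have eval_split u : eval 6 u p =
      u ^+ 2 *: (p 2 + u ^+ 2 *: p 4)
      + u *: (p 1 + u ^+ 2 *: p 3 + u ^+ 4 *: p 5).
    rewrite /eval !big_nat_recr //= big_geq // !add0r p0 p6 !scaler0 !addr0 !add0r.
    by rewrite !scalerDr !scalerA -exprD -!exprS expr1 [LHS](ACl (2*4*(1*3*5))).
  apply: (addrr_inj charF); rewrite addr0 /=.
  have := congr2 +%R (p_eval s) (p_eval (- s)).
  rewrite !eval_split !sqrrN scaleNr addr0 (exprNn s 4) -signr_odd /= mul1r.
  by rewrite addrACA subrr addr0.
have t_neq0 : t != 0 by apply: contraNneq t3 => ->; rewrite expr0n.
have /eqP := even_part t; rewrite scaler_eq0 expf_eq0 (negPf t_neq0) /=.
have := even_part 1; rewrite expr1n !scale1r => /(canRL (addrK _)) ->.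
rewrite sub0r addrC -[X in _ - X]scale1r -scalerBl scaler_eq0 subr_eq0.
case/orP => [/eqP t2|/eqP ->]; last by rewrite oppr0.
by move: t3; rewrite exprS t2 mulr1 eqxx.
Qed.

End CoefficientExtraction.

(** * The palintropic identity near an idempotent *)

Section Palintropic.

Variables (F : fieldType) (A : lmodType F) (mul : {bilinear A -> A -> A}).

Definition palintropic_poly (a : nat -> A) : nat -> A := fun n =>
  sq (poly_mul mul) (cube (poly_mul mul) a) n
    - cube (poly_mul mul) (sq (poly_mul mul) a) n.

(** Evaluation turns the formal difference into the identity at an element of A,
    and taking coefficients of top degree turns it into the identity at a 1. *)
Lemma palintropic_coef2 (a : nat -> A) (t : F) :
    2%N \notin [pchar F] -> t ^+ 3 != t -> palintropic23 mul -> deg_le a 1 ->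
  palintropic_poly a 2 = 0.
Proof.
move=> charF t3 palA a1.
have deg_sq n b : deg_le b n -> deg_le (sq (poly_mul mul) b) (n + n).
  by move=> bn; apply: deg_le_mul.
have deg_cube n b :
    deg_le b n -> deg_le (cube (poly_mul mul) b) (n + (n + n)).
  by move=> bn; apply: deg_le_mul => //; apply: deg_sq.
have [a2 a3] := (deg_sq _ _ a1, deg_cube _ _ a1).
apply: (coef2_eq0_of_vanishing charF t3) => [s|].
  rewrite /eval /palintropic_poly.
  under eq_bigr do rewrite scalerBr.
  rewrite sumrB -!/(eval _ _ _) -[RHS](palA (eval 1 s a)).
  congr (_ - _).
    by rewrite (eval_mul mul s a3 a3) (eval_mul mul s a1 a2) (eval_mul mul s a1 a1).
  rewrite (eval_mul mul s a2 (deg_sq _ _ a2)) (eval_mul mul s a2 a2).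
  by rewrite (eval_mul mul s a1 a1).
rewrite -[RHS](palA (a 1)) /palintropic_poly; congr (_ - _).
  rewrite [LHS](lead_coef_mul mul a3 a3) [cube _ a _](lead_coef_mul mul a1 a2).
  by rewrite [sq _ a _](lead_coef_mul mul a1 a1).
rewrite [LHS](lead_coef_mul mul a2 (deg_sq _ _ a2)).
rewrite (lead_coef_mul mul a2 a2 : sq _ (sq _ a) _ = _).
by rewrite [sq _ a _](lead_coef_mul mul a1 a1).
Qed.

Hypothesis mulC : forall x y : A, mul x y = mul y x.

Lemma mulDD x y : mul (x + y) (x + y) = mul x x + mul x y *+ 2 + mul y y.
Proof. by rewrite linearDl !linearDr (mulC y x) mulr2n !addrA. Qed.

Lemma mulBB x y : mul (x - y) (x - y) = mul x x - mul x y *+ 2 + mul y y.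
Proof. by rewrite mulDD linearNl !linearNr opprK mulNrn. Qed.

Lemma poly_mul_coef0 a b : poly_mul mul a b 0 = mul (a 0) (b 0).
Proof. by rewrite /poly_mul big_ord1. Qed.

Lemma poly_mul_coef1 a b :
  poly_mul mul a b 1 = mul (a 0) (b 1) + mul (a 1) (b 0).
Proof. by rewrite /poly_mul !big_ord_recr big_ord0 /= add0r. Qed.

Lemma poly_mul_coef2 a b :
  poly_mul mul a b 2 = mul (a 0) (b 2) + mul (a 1) (b 1) + mul (a 2) (b 0).
Proof. by rewrite /poly_mul !big_ord_recr big_ord0 /= add0r. Qed.

(** With L = mul c, q = 2 L y and s = y^2, the coefficients of degrees 0, 1, 2 are
      c, q, s                      for x^2,
      c, L (y + q), L s + y q      for x^3,
      c, 2 L q, 2 L s + q^2        for x^2 x^2.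
    The coefficient of t^2 in the difference is thus
      [(L (y + q))^2 - 2 q (L q)] - L [2 L s + q^2 + s - 2 (L s + y q)].
    As q = 2 L y, the first bracket is (u + v)^2 - 4 u v = (u - v)^2 for u = L y
    and v = L q; the second one is (y - q)^2. *)
Lemma palintropic_linear_poly_coef2 c y : mul c c = c ->
  let z := y - mul c y *+ 2 in
  palintropic_poly (linear_poly c y) 2
    = mul (mul c z) (mul c z) - mul c (mul z z).
Proof.
move=> cc /=; set q := mul c y *+ 2; set s := mul y y.
pose coefE := (poly_mul_coef0, poly_mul_coef1, poly_mul_coef2).
set a := linear_poly c y.
have sq0 : sq (poly_mul mul) a 0 = c by rewrite /sq coefE.
have sq1 : sq (poly_mul mul) a 1 = q by rewrite /sq coefE /= (mulC y c).
have sq2 : sq (poly_mul mul) a 2 = s.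
  by rewrite /sq coefE /= linear0r linear0l add0r addr0.
have cube0 : cube (poly_mul mul) a 0 = c by rewrite /cube coefE sq0.
have cube1 : cube (poly_mul mul) a 1 = mul c (y + q).
  by rewrite /cube coefE sq0 sq1 /= (mulC y c) addrC -linearDr.
have cube2 : cube (poly_mul mul) a 2 = mul c s + mul y q.
  by rewrite /cube coefE sq0 sq1 sq2 /= linear0l addr0.
have sqsq0 : sq (poly_mul mul) (sq (poly_mul mul) a) 0 = c.
  by rewrite {1}/sq coefE sq0.
have sqsq1 : sq (poly_mul mul) (sq (poly_mul mul) a) 1 = mul c q *+ 2.
  by rewrite {1}/sq coefE sq0 sq1 (mulC q c).
have sqsq2 : sq (poly_mul mul) (sq (poly_mul mul) a) 2
    = mul c s *+ 2 + mul q q.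
  by rewrite {1}/sq coefE sq0 sq1 sq2 (mulC s c) addrAC.
have cubesq2 : cube (poly_mul mul) (sq (poly_mul mul) a) 2
    = mul c (mul c s *+ 2 + mul q q) + mul q (mul c q *+ 2) + mul c s.
  by rewrite /cube coefE sq0 sq1 sq2 sqsq0 sqsq1 sqsq2 (mulC s c).
rewrite /palintropic_poly cubesq2 /sq coefE cube0 cube1 cube2.
rewrite ![mul (_ + _) c]mulC.
set D := mul (mul c (y + q)) _; set W := mul q (mul c q *+ 2).
have -> : mul (mul c (y - q)) (mul c (y - q)) = D - W.
  have -> : W = mul (mul c y) (mul c q) *+ 2 + mul (mul c y) (mul c q) *+ 2.
    by rewrite -mulr2n -linearMnl -linearMnr.
  rewrite /D [mul c (y + q)]linearDr [mul c (y - q)]linearBr mulBB mulDD.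
  move: (_ *+ 2) => uv2.
  by rewrite opprD addrA [_ + uv2 + _]addrAC addrK addrAC.
set cs := mul c s; set cyq := mul c (_ + _).
have -> : mul c (mul (y - q) (y - q))
    = mul c (cs *+ 2 + mul q q) + cs - cyq *+ 2.
  apply/(canRL (addrK _)).
  rewrite mulBB {}/cyq {}/cs -(linearMnr _ c) -!linearDr; congr (mul c _).
  rewrite mulrnDl; move: (mul y q *+ 2) (mul c s *+ 2) => yq2 cs2.
  by rewrite addrA [LHS](ACl (4*3*1*(2*5))) /= addNr addr0.
rewrite opprB mulr2n !opprD !addrA.
by rewrite [LHS](ACl (2*5*1*3*4*6)).
Qed.

(** Nonsingularity makes each x of the form y - 2 c y, and the coefficient of t^2
    at c + t y compares the two sides at that x. *)
Lemma idempotent_mul_sq c x :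
    (forall a, deg_le a 1 -> palintropic_poly a 2 = 0) ->
    mul c c = c -> nonsingular mul c ->
  mul c (mul x x) = mul (mul c x) (mul c x).
Proof.
move=> pal2 cc [g _ gK]; have := gK x; set y := g x => <-.
have := palintropic_linear_poly_coef2 y cc.
rewrite pal2; last exact: deg_le_linear_poly.
by move/esym/subr0_eq => E; rewrite scaler_nat E.
Qed.

Lemma idempotent_mul_hom c :
    2%N \notin [pchar F] ->
    (forall a, deg_le a 1 -> palintropic_poly a 2 = 0) ->
    mul c c = c -> nonsingular mul c ->
  forall x y, mul c (mul x y) = mul (mul c x) (mul c y).
Proof.
move=> charF pal2 cc c_ns x y; have c_sq := idempotent_mul_sq _ pal2 cc c_ns.
apply: (addrr_inj charF) => /=.
have := c_sq (x + y); rewrite [mul c (x + y)]linearDr !mulDD !linearDr !c_sq.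
by move/addIr/addrI; rewrite !mulr2n.
Qed.

End Palintropic.

(** * Multiplication by a nonsingular idempotent *)

Theorem theorem7p3 (F : fieldType) (charF : 2%N \notin [pchar F])
    (A : lmodType F) (mul : {bilinear A -> A -> A})
    (mulC : forall x y : A, mul x y = mul y x)
    (palA : palintropic23 mul)
    (* this hypothesis only concerns F = F_3 *)
    (palA3 : (forall t : F, t ^+ 3 = t) -> formally_palintropic23 mul)
    (c : A) (c_idm : c \in Idm mul) (c_ns : nonsingular mul c) :
  [/\ algebra_hom mul (mul c),
      forall c' : A, c' \in Idm mul -> mul c c' = 0 \/ mul c c' \in Idm mul
    & ker (mul c) =i Peirce mul c 0 /\ ideal mul (ker (mul c))].
Proof.
have cc : mul c c = c by case/andP: c_idm => _ /eqP.
(* Equality in F and in A is decidable, so a nonzero coefficient would force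
   t^3 = t for all t without any choice of t. *)
have pal2 a : deg_le a 1 -> palintropic_poly mul a 2 = 0.
  move=> a1; apply/eqP/negPn/negP => a2_neq0.
  have cubeF (t : F) : t ^+ 3 = t.
    apply/eqP/negPn/negP => t3; case/negP: a2_neq0; apply/eqP.
    exact: palintropic_coef2 t3 palA a1.
  by case/eqP: a2_neq0; apply: palA3 => //; exists 2.
have homc := idempotent_mul_hom mulC charF pal2 cc c_ns.
split.
- by split=> // k x y; rewrite linearDr linearZr_LR.
- move=> c' /andP[_ /eqP c'c']; have [->|cc'_neq0] := eqVneq (mul c c') 0.
    by left.
  by right; rewrite inE cc'_neq0 -homc c'c' eqxx.
- split=> [x|]; first by rewrite !inE scale0r subr0.
  split.
    split=> [|k x y]; first by rewrite inE linear0r.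
    rewrite !inE => /eqP cx /eqP cy.
    by rewrite linearDr linearZr_LR cx cy addr0 /= scaler0.
  move=> a x; rewrite !inE => /eqP cx.
  by rewrite !homc cx linear0r linear0l eqxx.
Qed.
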